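(* For $n\geq 3$ let $f(\overleftrightarrow{K}_{n})$ be the smallest integer such that every arc-colored $\overleftrightarrow{K}_{n}$ with at least $f(\overleftrightarrow{K}_{n})$ colors contains a rainbow triangle, and let $\mathcal{G}_n$ be the class of arc-colored complete digraphs $D$ of order $n$ such that $c(D)=f(\overleftrightarrow{K}_{n})-1$ and $D$ contains no rainbow triangle. Then: (1) Each $D\in\mathcal{G}_3$ can be decomposed into two arc-disjoint directed triangles $\Delta_1,\Delta_2$, each using exactly $2$ colors, with $C(\Delta_1)\cap C(\Delta_2)=\emptyset$. (2) For each $D\in\mathcal{G}_4$ there is an ordering $v_1,v_2,v_3,v_4$ of $V(D)$ such that $C(v_1v_2)=C(v_2v_3)=C(v_3v_4)=C(v_4v_1)=a$, $C(v_1v_4)=C(v_4v_3)=C(v_3v_2)=C(v_2v_1)=b$, $C(v_1v_3)=c$, $C(v_3v_1)=d$, $C(v_2v_4)=e$, $C(v_4v_2)=f$, where $a,b,c,d,e,f$ are pairwise distinct colors. (3) Each $D\in\mathcal{G}_5$ is of one of the following types: Type I: there is a vertex $v$ such that all arcs incident to $v$ have the same color $c$, $D-v\in\mathcal{G}_4$ and $c\notin C(D-v)$; Type II: $V(D)$ can be partitioned into $\{a_1,a_2\}$ and $\{b_1,b_2,b_3\}$ such that the spanning subdigraph $H$ with $A(H)=\{a_ib_j: i=1,2;\ j=1,2,3\}$ (or with $A(H)=\{b_ja_i: i=1,2;\ j=1,2,3\}$) is rainbow and all arcs of $A(D)\setminus A(H)$ have one and the same color, which does not occur on $A(H)$; Type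 III: $V(D)$ can be partitioned into $\{a_1,a_2\}$ and $\{b_1,b_2,b_3\}$ such that $C(D[\{a_1,a_2\}])=\{a,b\}$, $D[\{b_1,b_2,b_3\}]\in\mathcal{G}_3$ with $C(D[\{b_1,b_2,b_3\}])=\{c,d,e,f\}$, and all arcs between $\{a_1,a_2\}$ and $\{b_1,b_2,b_3\}$ (in both directions) have color $g$, where $a,b,c,d,e,f,g$ are pairwise distinct colors. (4) For each $D\in\mathcal{G}_n$ with $n\geq 6$, $V(D)$ can be partitioned into $\{a_1,\ldots,a_{\lfloor n/2\rfloor}\}$ and $\{b_1,\ldots,b_{\lceil n/2\rceil}\}$ such that the spanning subdigraph $H$ with $A(H)=\{a_ib_j: 1\le i\le\lfloor n/2\rfloor,\ 1\le j\le\lceil n/2\rceil\}$ or with $A(H)=\{b_ja_i: 1\le i\le\lfloor n/2\rfloor,\ 1\le j\le\lceil n/2\rceil\}$ is rainbow and all arcs in $A(D)\setminus A(H)$ have one and the same color, which does not occur on $A(H)$.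
   Context: All digraphs are finite, without loops or multiple arcs (opposite arcs $xy,yx$ allowed). $\overleftrightarrow{K}_{n}$ is the complete digraph on $n$ vertices (both arcs between every pair of vertices). An arc-coloring is any map $C:A(D)\to\mathbb{N}$; $C(D)$ is the set and $c(D)$ the number of colors used on $A(D)$. A digraph is rainbow if its arcs have pairwise distinct colors; a rainbow triangle is a rainbow directed cycle of length 3. $D[S]$ is the subdigraph induced by $S$, and $D-v$ is obtained by deleting vertex $v$. *)

(* Defs.v *)
From mathcomp Require Import all_boot.
Set Implicit Arguments. Unset Strict Implicit. Unset Printing Implicit Defensive.

(* An arc-colored complete digraph with vertex set V (a finite type) is a map
   C : V -> V -> nat; only the values C x y with x != y (the arcs) matter. *)

Definition colors (V : finType) (C : V -> V -> nat) : seq nat :=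
  undup [seq C p.1 p.2 | p <- enum [pred p : V * V | p.1 != p.2]].

Definition ncolors (V : finType) (C : V -> V -> nat) : nat := size (colors C).

Definition rainbow_triangle (V : finType) (C : V -> V -> nat) (x y z : V) : Prop :=
  [/\ x != y, y != z & z != x] /\
  [/\ C x y != C y z, C y z != C z x & C z x != C x y].

Definition has_rainbow_triangle (V : finType) (C : V -> V -> nat) : Prop :=
  exists x y z, rainbow_triangle C x y z.

Definition f_prop (n k : nat) : Prop :=
  forall C : 'I_n -> 'I_n -> nat, k <= ncolors C -> has_rainbow_triangle C.

Definition is_f (n k : nat) : Prop :=
  f_prop n k /\ forall j, f_prop n j -> k <= j.

Definition inG (n : nat) (V : finType) (C : V -> V -> nat) : Prop :=
  #|V| = n /\
  (exists k, is_f n k /\ ncolors C + 1 = k) /\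
  ~ has_rainbow_triangle C.

Definition induced (V : finType) (C : V -> V -> nat) (S : {set V})
  : {x : V | x \in S} -> {x : V | x \in S} -> nat :=
  fun x y => C (val x) (val y).

Definition delv (V : finType) (C : V -> V -> nat) (v : V)
  : {x : V | x \in [set~ v]} -> {x : V | x \in [set~ v]} -> nat :=
  @induced V C [set~ v].
Arguments delv {V} C v _ _.
Arguments induced {V} C S _ _.

Definition bip_structure (V : finType) (C : V -> V -> nat) (X Y : {set V}) : Prop :=
  (forall x1 y1 x2 y2, x1 \in X -> y1 \in Y -> x2 \in X -> y2 \in Y ->
      C x1 y1 = C x2 y2 -> x1 = x2 /\ y1 = y2) /\
  exists c : nat,
    (forall x y, x != y -> ~~ ((x \in X) && (y \in Y)) -> C x y = c) /\
    (forall x y, x \in X -> y \in Y -> C x y != c).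

Definition partition2 (V : finType) (A B : {set V}) (p q : nat) : Prop :=
  [/\ A :&: B = set0, A :|: B = setT, #|A| = p & #|B| = q].

Definition typeI (V : finType) (C : V -> V -> nat) : Prop :=
  exists (v : V) (c : nat),
    (forall u, u != v -> C u v = c /\ C v u = c) /\
    inG 4 (delv C v) /\ c \notin colors (delv C v).

Definition typeII (V : finType) (C : V -> V -> nat) : Prop :=
  exists A B : {set V}, partition2 A B 2 3 /\
    (bip_structure C A B \/ bip_structure C B A).

Definition typeIII (V : finType) (C : V -> V -> nat) : Prop :=
  exists (A B : {set V}) (a b c d e f g : nat),
    [/\ partition2 A B 2 3,
        uniq [:: a; b; c; d; e; f; g],
        colors (@induced V C A) =i [:: a; b],
        inG 3 (@induced V C B) /\ colors (@induced V C B) =i [:: c; d; e; f]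
      & forall x y, ((x \in A) && (y \in B)) || ((x \in B) && (y \in A)) ->
          C x y = g].

(* Main.v *)
(* Call a color saturated at v if it only occurs on arcs incident to v; deleting
   v loses exactly these colors.  If v -> x and y -> v (x <> y) carry distinct
   colors saturated at v, the arc x -> y, which avoids v, closes a rainbow
   triangle.  So a vertex with at least three saturated colors is a source (all
   its saturated arcs leave it) or a sink.  For n >= 6, comparing with the
   maximum for n - 1 gives every vertex at least floor(n/2) >= 3 saturated
   colors.  Saturated arcs lead from sources to sinks, so both classes have at
   least floor(n/2) elements, which yields the upper bound, and in the extremal
   case the remaining arcs are forced to have one color, because v -> x
   saturated at a source v forces C x y = C y v for every y.

   The cases n = 4 and n = 5 end in a verified exhaustive search: a triangle that
   is not rainbow identifies two of its three color classes, and a branch dies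
   once too few classes remain.  For n = 5 the search starts from one vertex v.
   If v has at most one saturated color, then D - v is an extremal coloring of
   order 4; otherwise v is a source or a sink, or has two differently colored
   saturated arcs vx and xv. *)
Require Import Defs.
From mathcomp Require Import all_boot zify.
Set Implicit Arguments. Unset Strict Implicit. Unset Printing Implicit Defensive.

(** * Exhaustive search over partitions of the arcs into color classes *)

Section Search.
Variables (n k : nat) (leaf : seq nat -> bool).

Definition code (e : nat * nat) : nat := e.1 * n + e.2.

Definition arcs (P : rel nat) : seq nat :=
  [seq code e | e <- [seq (i, j) | i <- iota 0 n, j <- iota 0 n] &
                     (e.1 != e.2) && P e.1 e.2].

(** Each triple x < y < z enters once in each orientation. Being rainbow is invariant under
    rotation, so these two cyclic orders cover all directed triangles on the triple. *)
Definition triangles : seq (nat * nat * nat) :=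
  flatten [seq flatten [seq flatten [seq
    [:: (code (x, y), code (y, z), code (z, x));
        (code (x, z), code (z, y), code (y, x))]
    | x <- iota 0 y] | y <- iota 0 z] | z <- iota 0 n].

Definition merge_classes (p q : nat) (s : seq nat) : seq nat :=
  [seq if x == q then p else x | x <- s].

(* A list s of classes maps the code of an arc to a representative of its color
   class.  Codes of loops are sent to the arc (0, 1), so as not to add classes. *)
Definition discrete_classes : seq nat :=
  mkseq (fun a => if a %/ n == a %% n then 1 else a) (n * n).

Definition initial_classes (eqs : seq (nat * nat)) : seq nat :=
  foldl (fun s e => merge_classes (nth 0 s e.1) (nth 0 s e.2) s)
        discrete_classes eqs.

(* Nested ifs rather than ||: vm_compute is call-by-value and would not prune. *)
Fixpoint search (tris : seq (nat * nat * nat)) (s : seq nat)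
    (neqs : seq (nat * nat)) : bool :=
  if size (undup s) < k then true else
  if has (fun e => nth 0 s e.1 == nth 0 s e.2) neqs then true else
  match tris with
  | [::] => leaf s
  | (a, b, d) :: tris' =>
    let x := nth 0 s a in let y := nth 0 s b in let z := nth 0 s d in
    if [|| x == y, y == z | z == x] then search tris' s neqs else
    [&& search tris' (merge_classes x y s) neqs,
        search tris' (merge_classes y z s) ((a, b) :: neqs)
      & search tris' (merge_classes z x s) ((a, b) :: (b, d) :: neqs)]
  end.

Variable c : nat -> nat.

Lemma map_merge_classes (p q : nat) (s : seq nat) :
  c p = c q -> map c (merge_classes p q s) = map c s.
Proof.
move=> cpq; rewrite -map_comp; apply: eq_map => x /=.
by case: eqP => [->|].
Qed.

(** With [c 0] as the default value, the identity also holds past the end of [s]. *)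
Lemma nth_map_default (s : seq nat) (a : nat) :
  c (nth 0 s a) = nth (c 0) (map c s) a.
Proof.
case: (ltnP a (size s)) => [lt_as|le_sa]; first by rewrite (nth_map 0).
by rewrite !nth_default ?size_map.
Qed.

Lemma size_undup_map (s : seq nat) : size (undup (map c s)) <= size (undup s).
Proof.
rewrite -[size (undup s)](size_map c); apply: uniq_leq_size (undup_uniq _) _ => x.
by rewrite mem_undup => /mapP[y y_s ->]; rewrite map_f ?mem_undup.
Qed.

(** Follow the branch that is true of [c]: at each triangle, the first of the three color equalities
    that holds, the earlier ones being recorded as inequalities. The invariant [map c s = cs] says
    that only equally colored arcs have been merged, so this branch is never pruned and ends in a
    leaf. *)
Lemma search_sound (cs : seq nat) tris (s : seq nat) neqs :
  k <= size (undup cs) ->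
  (forall t, t \in tris -> let col := nth (c 0) cs in
     [|| col t.1.1 == col t.1.2, col t.1.2 == col t.2 | col t.2 == col t.1.1]) ->
  (forall e, e \in neqs -> nth (c 0) cs e.1 != nth (c 0) cs e.2) ->
  map c s = cs -> search tris s neqs ->
  exists2 s', map c s' = cs & leaf s'.
Proof.
move=> le_k; elim: tris s neqs => [|[[a b] d] tris IH] s neqs Htri Hneq Es /=.
all: case: ltnP => [lt_sk|_].
all: try by move: (leq_ltn_trans (size_undup_map s) lt_sk); rewrite Es ltnNge le_k.
all: case: hasP => [[e e_neq /eqP Ee]|_ Hsearch].
all: try by move: (Hneq e e_neq); rewrite -Es -!nth_map_default Ee eqxx.
  by exists s.
have {}IH := IH _ _ (fun t t_tris => Htri t (@mem_behead _ (_ :: tris) t t_tris)).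
have := Htri _ (mem_head _ _); rewrite /= => Hd.
move: Hsearch; case: ifP => [_|_ /and3P[H1 H2 H3]]; first exact: IH Hneq Es.
case: (eqVneq (nth (c 0) cs a) (nth (c 0) cs b)) Hd => [Eab _|Nab].
  by apply: (IH _ _ Hneq _ H1); rewrite map_merge_classes // !nth_map_default Es.
case: (eqVneq (nth (c 0) cs b) (nth (c 0) cs d)) => [Ebd _|Nbd /eqP Eda].
  apply: (IH _ _ _ _ H2); last first.
    by rewrite map_merge_classes // !nth_map_default Es.
  by move=> e; rewrite inE => /predU1P[->|/Hneq].
apply: (IH _ _ _ _ H3); last first.
  by rewrite map_merge_classes // !nth_map_default Es.
by move=> e; rewrite !inE => /predU1P[->|/predU1P[->|/Hneq]].
Qed.

Lemma map_initial_classes (eqs : seq (nat * nat)) :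
  let cs := map c discrete_classes in
  (forall e, e \in eqs -> nth (c 0) cs e.1 = nth (c 0) cs e.2) ->
  map c (initial_classes eqs) = cs.
Proof.
move=> cs; rewrite /initial_classes.
have: map c discrete_classes = cs by [].
elim: eqs discrete_classes => //= e eqs IH s Es Heq.
apply: IH => [|e' e'_eqs]; last by apply: Heq; rewrite inE e'_eqs orbT.
by rewrite map_merge_classes // !nth_map_default Es Heq ?mem_head.
Qed.

End Search.

(** * From lists of classes to colorings of a vertex set *)

Definition monochromatic (n : nat) (P : rel nat) (s : seq nat) : bool :=
  constant [seq nth 0 s a | a <- arcs n P].

Section Bridge.
Variables (V : finType) (C : V -> V -> nat) (x0 : V) (vs : seq V).
Hypotheses (vs_uniq : uniq vs) (vs_all : forall x, x \in vs).
Let n := size vs.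
Let v (i : nat) := nth x0 vs i.
Hypothesis n_gt1 : 1 < n.

Definition code_color (a : nat) : nat := C (v (a %/ n)) (v (a %% n)).

Lemma code_colorE (i j : nat) : j < n -> code_color (code n (i, j)) = C (v i) (v j).
Proof.
move=> lt_jn; rewrite /code_color /code divnMDl ?modnMDl; last exact: ltnW.
by rewrite divn_small // addn0 modn_small.
Qed.

Lemma nth_discrete_classes (i j : nat) : i < n -> j < n -> i != j ->
  nth (code_color 0) (map code_color (discrete_classes n)) (code n (i, j)) = C (v i) (v j).
Proof.
move=> lt_in lt_jn ne_ij; rewrite -nth_map_default nth_mkseq.
  rewrite {1 2}/code divnMDl ?modnMDl ?(ltnW n_gt1) // divn_small // addn0.
  by rewrite modn_small //= (negPf ne_ij) code_colorE.
by move: lt_in lt_jn; rewrite /code /=; clear; nia.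
Qed.

Lemma mem_arcs (P : rel nat) (i j : nat) : i < n -> j < n -> i != j -> P i j ->
  code n (i, j) \in arcs n P.
Proof.
move=> lt_in lt_jn ne_ij Pij; apply/map_f; rewrite mem_filter /= ne_ij Pij /=.
by apply: allpairs_f; rewrite mem_iota.
Qed.

Lemma monochromaticP (P : rel nat) (s : seq nat) :
  map code_color s = map code_color (discrete_classes n) -> monochromatic n P s ->
  exists c, forall i j, i < n -> j < n -> i != j -> P i j -> C (v i) (v j) = c.
Proof.
move=> Es /(constantP 0)[c Ec]; exists (code_color c) => i j lt_in lt_jn ne_ij Pij.
rewrite -nth_discrete_classes // -Es -nth_map_default; congr code_color.
have : nth 0 s (code n (i, j)) \in [seq nth 0 s a | a <- arcs n P].
  exact/map_f/mem_arcs.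
by rewrite Ec => /nseqP[].
Qed.

Lemma monochromatic_index (P : rel nat) (s : seq nat) :
  map code_color s = map code_color (discrete_classes n) -> monochromatic n P s ->
  exists c, forall x y, x != y -> P (index x vs) (index y vs) -> C x y = c.
Proof.
move=> Es /(monochromaticP Es)[c Ec]; exists c => x y ne_xy Pxy.
rewrite -(nth_index x0 (vs_all x)) -(nth_index x0 (vs_all y)); apply: Ec => //.
- by rewrite index_mem.
- by rewrite index_mem.
by apply: contraNneq ne_xy => E; rewrite -(nth_index x0 (vs_all x)) E nth_index.
Qed.

(** Equalities and inequalities refer to positions in the enumeration [vs]. They must concern
    genuine arcs, since [discrete_classes] puts loops into the class of an arc. *)
Lemma search_colors (k : nat) (leaf : seq nat -> bool)
    (eqs neqs : seq ((nat * nat) * (nat * nat))) :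
  ~ has_rainbow_triangle C -> k <= ncolors C ->
  (forall e, e \in eqs ->
     [&& e.1.1 < n, e.1.2 < n, e.1.1 != e.1.2, e.2.1 < n, e.2.2 < n & e.2.1 != e.2.2] /\
     C (v e.1.1) (v e.1.2) = C (v e.2.1) (v e.2.2)) ->
  (forall e, e \in neqs ->
     [&& e.1.1 < n, e.1.2 < n, e.1.1 != e.1.2, e.2.1 < n, e.2.2 < n & e.2.1 != e.2.2] /\
     C (v e.1.1) (v e.1.2) <> C (v e.2.1) (v e.2.2)) ->
  search k leaf (triangles n) (initial_classes n [seq (code n e.1, code n e.2) | e <- eqs])
    [seq (code n e.1, code n e.2) | e <- neqs] ->
  exists2 s, map code_color s = map code_color (discrete_classes n) & leaf s.
Proof.
move=> norb le_k Heq Hneq; apply: (@search_sound _ _ code_color).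
(* Every color of [C] occurs in the list at the code of its arc, so the list has at least
   [ncolors C] distinct entries. *)
- apply: leq_trans le_k _; apply: uniq_leq_size (undup_uniq _) _ => col.
  rewrite !mem_undup => /mapP[[x y]]; rewrite mem_enum inE /= => ne_xy ->.
  have ltx z : index z vs < n by rewrite index_mem.
  have nei : index x vs != index y vs.
    by apply: contraNneq ne_xy => E; rewrite -(nth_index x0 (vs_all x)) E nth_index.
  have := nth_discrete_classes (ltx x) (ltx y) nei.
  rewrite /v !nth_index // => <-; apply: mem_nth.
  rewrite size_map size_mkseq /code /=; move: (ltx x) (ltx y); nia.
- move=> t /flattenP[_ /mapP[z z_n ->]] /flattenP[_ /mapP[y y_z ->]].
  move=> /flattenP[_ /mapP[x x_y ->]]; move: x_y y_z z_n; rewrite !mem_iota /= !add0n.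
  move=> lt_xy lt_yz lt_zn.
  have lt_yn := ltn_trans lt_yz lt_zn; have lt_xn := ltn_trans lt_xy lt_yn.
  have ne_xy : x != y by rewrite neq_ltn lt_xy.
  have ne_yz : y != z by rewrite neq_ltn lt_yz.
  have ne_xz : x != z by rewrite neq_ltn (ltn_trans lt_xy).
  have [ne_yx ne_zy ne_zx] : [/\ y != x, z != y & z != x].
    by rewrite eq_sym ne_xy eq_sym ne_yz eq_sym.
  have nv i j : i < n -> j < n -> i != j -> v i != v j by move=> *; rewrite nth_uniq.
  rewrite !inE => /orP[]/eqP-> /=; rewrite !nth_discrete_classes //.
    apply/negPn/negP; rewrite !negb_or => /and3P[h1 h2 h3]; apply: norb.
    by exists (v x), (v y), (v z); split; split; rewrite ?nv.
  apply/negPn/negP; rewrite !negb_or => /and3P[h1 h2 h3]; apply: norb.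
  by exists (v x), (v z), (v y); split; split; rewrite ?nv.
- move=> _ /mapP[[[a b] [d e]] /Hneq[/= /and5P[? ? ? ? /andP[? ?]] /eqP ?] ->] /=.
  by rewrite !nth_discrete_classes.
- apply: map_initial_classes => _ /mapP[[[a b] [d e]] /Heq[/= /and5P[? ? ? ? /andP[? ?]] ?] ->] /=.
  by rewrite !nth_discrete_classes.
Qed.
End Bridge.

(** * Sets of colors, induced colorings and the extremal number *)

Section Colors.
Variables (V : finType) (C : V -> V -> nat).

Lemma colorsP (c : nat) : reflect (exists x y, x != y /\ C x y = c) (c \in colors C).
Proof.
rewrite mem_undup; apply: (iffP mapP) => [[[x y]]|[x [y [ne_xy <-]]]].
  by rewrite mem_enum inE /= => ne_xy ->; exists x, y.
by exists (x, y); rewrite ?mem_enum ?inE.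
Qed.

Lemma ncolors_leq (cs : seq nat) : {subset colors C <= cs} -> ncolors C <= size cs.
Proof. exact/uniq_leq_size/undup_uniq. Qed.

Lemma ncolors_geq (cs : seq nat) : uniq cs -> {subset cs <= colors C} -> size cs <= ncolors C.
Proof. exact: uniq_leq_size. Qed.

Lemma ncolors_uniq (cs : seq nat) :
  {subset colors C <= cs} -> size cs <= ncolors C -> uniq cs.
Proof. exact/leq_size_uniq/undup_uniq. Qed.

(** Searching the finite vertex set decides this constructively; [is_fI] thereby turns a bound for
    colorings without rainbow triangle into the existence of one. *)
Lemma rainbow_dec : has_rainbow_triangle C \/ ~ has_rainbow_triangle C.
Proof.
pose rb x y z := [&& x != y, y != z & z != x] &&
  [&& C x y != C y z, C y z != C z x & C z x != C x y].
case: (boolP [exists x, exists y, exists z, rb x y z]) => [|/negP norb].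
  case/existsP=> x /existsP[y /existsP[z /andP[/and3P[? ? ?] /and3P[? ? ?]]]].
  by left; exists x, y, z.
right=> -[x [y [z [[h1 h2 h3] [h4 h5 h6]]]]]; apply: norb.
by do 3![apply/existsP; eexists]; apply/andP; split; apply/and3P; split; eassumption.
Qed.

Lemma triangle_eq (x y z : V) : ~ has_rainbow_triangle C ->
  x != y -> y != z -> z != x ->
  [\/ C x y = C y z, C y z = C z x | C z x = C x y].
Proof.
move=> norb ne_xy ne_yz ne_zx.
case: (eqVneq (C x y) (C y z)) => [|h1]; first by constructor 1.
case: (eqVneq (C y z) (C z x)) => [|h2]; first by constructor 2.
case: (eqVneq (C z x) (C x y)) => [|h3]; first by constructor 3.
by case: norb; exists x, y, z.
Qed.


End Colors.

Section Induced.
Variables (V : finType) (C : V -> V -> nat) (S : {set V}).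

Lemma colors_inducedP (c : nat) :
  reflect (exists x y, [/\ x \in S, y \in S, x != y & C x y = c]) (c \in colors (induced C S)).
Proof.
apply: (iffP (colorsP _ _)) => [[x [y [ne_xy <-]]]|[x [y [Sx Sy ne_xy <-]]]].
  by exists (val x), (val y); rewrite !(valP x, valP y).
by exists (exist _ x Sx), (exist _ y Sy).
Qed.

Lemma induced_no_rainbow : ~ has_rainbow_triangle C -> ~ has_rainbow_triangle (induced C S).
Proof.
by move=> norb [x [y [z rb]]]; apply: norb; exists (val x), (val y), (val z).
Qed.

Lemma card_induced : #|{: {x : V | x \in S}}| = #|S|.
Proof. by rewrite card_sig. Qed.

End Induced.

Lemma colors_delvP (V : finType) (C : V -> V -> nat) (v : V) (c : nat) :
  reflect (exists x y, [/\ x != v, y != v, x != y & C x y = c]) (c \in colors (delv C v)).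
Proof.
apply: (iffP (colors_inducedP _ _ _)) => -[x [y [xv yv ne_xy <-]]]; exists x, y.
  by rewrite !inE in xv yv.
by rewrite !inE.
Qed.

Lemma is_fI (n k : nat) :
  (forall C : 'I_n -> 'I_n -> nat, ~ has_rainbow_triangle C -> ncolors C <= k) ->
  (exists2 C : 'I_n -> 'I_n -> nat, k <= ncolors C & ~ has_rainbow_triangle C) ->
  is_f n k.+1.
Proof.
move=> ub [C0 le_k norb0]; split=> [C lt_k|j fj].
  by case: (rainbow_dec C) => // /ub; rewrite leqNgt lt_k.
by rewrite ltnNge; apply/negP=> le_jk; apply/norb0/fj/leq_trans/le_k.
Qed.

(** The least value is unique by minimality on both sides, so knowing one value of f fixes the
    number of colors of every extremal coloring. *)
Lemma inG_ncolors (n k : nat) (V : finType) (C : V -> V -> nat) :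
  is_f n k.+1 -> inG n C -> [/\ #|V| = n, ncolors C = k & ~ has_rainbow_triangle C].
Proof.
move=> [fk mink] [Vn [[j [[fj minj]]]]]; rewrite addn1 => Ej norb; split=> //.
by apply/eq_add_S/eqP; rewrite Ej eqn_leq minj ?mink.
Qed.

(** Lower bounds come from colorings written on natural numbers, as tables or formulas, and
    restricted to the ordinals below [n]. *)
Lemma extremal_coloring (n : nat) (C : nat -> nat -> nat) (cs : seq nat) :
  uniq cs ->
  (forall c, c \in cs -> exists i j, [/\ i < n, j < n, i != j & C i j = c]) ->
  (forall i j k, i < n -> j < n -> k < n -> i != j -> j != k -> k != i ->
     [|| C i j == C j k, C j k == C k i | C k i == C i j]) ->
  exists2 C' : 'I_n -> 'I_n -> nat, size cs <= ncolors C' & ~ has_rainbow_triangle C'.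
Proof.
move=> cs_uniq cs_C norb; exists (fun i j => C i j).
  apply: ncolors_geq => // c /cs_C[i [j [lt_in lt_jn ne_ij <-]]].
  by apply/colorsP; exists (Ordinal lt_in), (Ordinal lt_jn).
move=> [i [j [k [[ne_ij ne_jk ne_ki] [h1 h2 h3]]]]].
have := norb i j k (ltn_ord i) (ltn_ord j) (ltn_ord k) ne_ij ne_jk ne_ki.
by rewrite (negPf h1) (negPf h2) (negPf h3).
Qed.

Definition table_color (n : nat) (t : seq nat) (i j : nat) : nat := nth 0 t (i * n + j).

Lemma extremal_table (n k : nat) (t : seq nat) :
  all (fun c => has (fun i => has (fun j => (i != j) && (table_color n t i j == c))
                          (iota 0 n)) (iota 0 n)) (iota 0 k) ->
  all (fun i => all (fun j => all (fun l =>
     let C := table_color n t in [&& i != j, j != l & l != i] ==>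
     [|| C i j == C j l, C j l == C l i | C l i == C i j])
     (iota 0 n)) (iota 0 n)) (iota 0 n) ->
  exists2 C : 'I_n -> 'I_n -> nat, k <= ncolors C & ~ has_rainbow_triangle C.
Proof.
move=> cols norb; rewrite -{1}[k](size_iota 0).
apply: (@extremal_coloring n (table_color n t)); first exact: iota_uniq.
  move=> c /(allP cols)/hasP[i]; rewrite mem_iota => /= lt_in.
  by case/hasP=> j; rewrite mem_iota => /= lt_jn /andP[ne_ij /eqP Ec]; exists i, j.
move=> i j l lt_in lt_jn lt_ln ne_ij ne_jl ne_li.
have mem m : m < n -> m \in iota 0 n by rewrite mem_iota.
have := allP (allP (allP norb i (mem i lt_in)) j (mem j lt_jn)) l (mem l lt_ln).
by rewrite /= ne_ij ne_jl ne_li.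
Qed.

(** * Order 3: two arc-disjoint triangles *)

Lemma size_undup3 (a b c : nat) :
  [\/ a = b, b = c | c = a] -> size (undup [:: a; b; c]) <= 2.
Proof.
by case=> -> /=; rewrite !inE ?eqxx ?orbT //=; case: ifP.
Qed.

Section Order3.
Variables (V : finType) (C : V -> V -> nat) (x y z : V).
Hypotheses (V_xyz : forall u, u \in [:: x; y; z]) (xyz_uniq : uniq [:: x; y; z]).
Hypothesis norb : ~ has_rainbow_triangle C.
Let t1 := [:: C x y; C y z; C z x].
Let t2 := [:: C x z; C z y; C y x].

Lemma colors3 : {subset colors C <= undup t1 ++ undup t2}.
Proof.
move=> c /colorsP[u [w [ne_uw <-]]]; rewrite mem_cat !mem_undup /t1 /t2.
move: (V_xyz u) (V_xyz w) ne_uw; rewrite !inE => /or3P[]/eqP-> /or3P[]/eqP->.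
all: by rewrite ?eqxx ?orbT ?implybT.
Qed.

Let neqs : [/\ x != y, y != z & z != x].
Proof.
move: xyz_uniq; rewrite /= !inE negb_or => /and3P[/andP[-> ne_xz] -> _].
by rewrite eq_sym.
Qed.

Lemma undup_t1 : size (undup t1) <= 2.
Proof.
by case: neqs => *; apply: size_undup3; apply: triangle_eq.
Qed.

Lemma undup_t2 : size (undup t2) <= 2.
Proof.
by case: neqs => *; apply: size_undup3; apply: triangle_eq => //; rewrite eq_sym.
Qed.

Lemma ncolors3 : ncolors C <= 4.
Proof.
by apply: leq_trans (ncolors_leq colors3) _; rewrite size_cat (leq_add undup_t1 undup_t2).
Qed.

(** Each triangle contributes at most two colors, so four colors force two from each, and the
    concatenated list of colors has no repetition, which makes the two sets disjoint. *)
Lemma structure3 : 4 <= ncolors C ->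
  [/\ size (undup t1) = 2, size (undup t2) = 2 & all (fun c => c \notin t2) t1].
Proof.
move=> ge4; have le4 := leq_add undup_t1 undup_t2.
have le_cat := ncolors_leq colors3; rewrite size_cat in le_cat.
have := ncolors_uniq colors3; rewrite size_cat (leq_trans le4 ge4) => /(_ isT).
rewrite cat_uniq => /and3P[_ /hasPn dis _].
have h1 := undup_t1; have h2 := undup_t2.
have le_t12 : 4 <= size (undup t1) + size (undup t2) := leq_trans ge4 le_cat.
clear - h1 h2 dis le_t12; split; last apply/allP=> c c1.
- by move: h1 h2 le_t12; move: (size _) (size _) => a b; lia.
- by move: h1 h2 le_t12; move: (size _) (size _) => a b; lia.
by apply/negP=> c2; have := dis c; rewrite !mem_undup => /(_ c2); rewrite c1.
Qed.

End Order3.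

(** Chosen vertices are put at the head of an enumeration, where the equations and inequalities of a
    search can refer to them by position. *)
Lemma enum_prefix (V : finType) (s : seq V) : uniq s ->
  exists t, [/\ uniq (s ++ t), forall x, x \in s ++ t & size (s ++ t) = #|V|].
Proof.
move=> s_uniq; exists [seq x <- enum V | x \notin s].
have st_uniq : uniq (s ++ [seq x <- enum V | x \notin s]).
  rewrite cat_uniq s_uniq filter_uniq ?enum_uniq // andbT.
  by apply/hasPn=> x; rewrite mem_filter => /andP[].
have st_all x : x \in s ++ [seq x <- enum V | x \notin s].
  by rewrite mem_cat mem_filter mem_enum andbT orbN.
split=> //; rewrite -(card_uniqP st_uniq).
by apply: eq_card => x; rewrite st_all.
Qed.

Lemma card3P (V : finType) : #|V| = 3 ->
  exists x y z : V, uniq [:: x; y; z] /\ forall u, u \in [:: x; y; z].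
Proof.
move=> V3; have [s [s_uniq s_all s_size]] := @enum_prefix V [::] isT.
by case: s s_uniq s_all s_size => [|x [|y [|z [|w s]]]] ? ?; rewrite V3 // => _; exists x, y, z.
Qed.

Lemma ncolors_card3 (V : finType) (C : V -> V -> nat) :
  #|V| = 3 -> ~ has_rainbow_triangle C -> ncolors C <= 4.
Proof.
by move=> /card3P[x [y [z [xyz_uniq V_xyz]]]] norb; apply: (ncolors3 V_xyz).
Qed.

Lemma is_f3 : is_f 3 5.
Proof.
apply: is_fI => [C|]; first by apply: ncolors_card3; rewrite card_ord.
(* Rows of the color matrix; the entries 9 stand for the loops. The two triangles use the colors 0,
   1 and 2, 3. *)
by apply: (@extremal_table 3 4 [:: 9; 0; 3; 2; 9; 0; 1; 2; 9]); vm_compute.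
Qed.

(** * Order 4: a monochromatic Hamiltonian cycle and its monochromatic reverse *)

Definition cycles4 : seq (seq nat) := [:: [:: 0; 1; 2; 3]; [:: 0; 1; 3; 2]; [:: 0; 2; 1; 3]].

Definition leaf4 (s : seq nat) : bool :=
  has (fun o => monochromatic 4 (fun i j => next o i == j) s &&
                monochromatic 4 (fun i j => prev o i == j) s) cycles4.

Lemma search4 : search 6 leaf4 (triangles 4) (initial_classes 4 [::]) [::].
Proof. by vm_compute. Qed.

(** The leaves of the search offer the three undirected Hamiltonian cycles on four vertices. Only
    the two monochromatic cycles are extracted; that the six colors are distinct follows later by
    counting. *)
Lemma structure4 (V : finType) (C : V -> V -> nat) :
  #|V| = 4 -> ~ has_rainbow_triangle C -> 6 <= ncolors C ->
  exists (v1 v2 v3 v4 : V) (a b : nat),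
    [/\ uniq [:: v1; v2; v3; v4], forall x, x \in [:: v1; v2; v3; v4],
        [/\ C v1 v2 = a, C v2 v3 = a, C v3 v4 = a & C v4 v1 = a]
      & [/\ C v1 v4 = b, C v4 v3 = b, C v3 v2 = b & C v2 v1 = b]].
Proof.
move=> V4 norb ge6; have [vs [vs_uniq vs_all]] := @enum_prefix V [::] isT.
rewrite V4; case: vs vs_uniq vs_all => [|w0 [|w1 [|w2 [|w3 [|w4 vs]]]]] // vs_uniq vs_all _.
pose vs := [:: w0; w1; w2; w3].
have [//|//|s Es] := search_colors (x0 := w0) (vs := vs) vs_uniq vs_all isT norb ge6
  (eqs := [::]) (neqs := [::]) _ _ search4.
have mono P := @monochromaticP _ _ w0 vs isT P s Es.
have cycle w1' w2' w3' : perm_eq [:: w0; w1'; w2'; w3'] vs ->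
    (exists a, [/\ C w0 w1' = a, C w1' w2' = a, C w2' w3' = a & C w3' w0 = a]) ->
    (exists b, [/\ C w0 w3' = b, C w3' w2' = b, C w2' w1' = b & C w1' w0 = b]) ->
  exists (v1 v2 v3 v4 : V) (a b : nat),
    [/\ uniq [:: v1; v2; v3; v4], forall x, x \in [:: v1; v2; v3; v4],
        [/\ C v1 v2 = a, C v2 v3 = a, C v3 v4 = a & C v4 v1 = a]
      & [/\ C v1 v4 = b, C v4 v3 = b, C v3 v2 = b & C v2 v1 = b]].
  move=> Et [a Ha] [b Hb]; exists w0, w1', w2', w3', a, b.
  by rewrite (perm_uniq Et); split=> // x; rewrite (perm_mem Et).
case/or4P=> // /andP[/mono[a Ha] /mono[b Hb]].
- apply: (cycle w1 w2 w3) => //; [exists a | exists b].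
    by split; [apply: (Ha 0 1) | apply: (Ha 1 2) | apply: (Ha 2 3) | apply: (Ha 3 0)].
  by split; [apply: (Hb 0 3) | apply: (Hb 3 2) | apply: (Hb 2 1) | apply: (Hb 1 0)].
- apply: (cycle w1 w3 w2); [|exists a | exists b].
  + by rewrite !perm_cons (perm_catC [:: w3] [:: w2]).
  + by split; [apply: (Ha 0 1) | apply: (Ha 1 3) | apply: (Ha 3 2) | apply: (Ha 2 0)].
  by split; [apply: (Hb 0 2) | apply: (Hb 2 3) | apply: (Hb 3 1) | apply: (Hb 1 0)].
- apply: (cycle w2 w1 w3); [|exists a | exists b].
  + by rewrite perm_cons (perm_catCA [:: w2] [:: w1] [:: w3]).
  + by split; [apply: (Ha 0 2) | apply: (Ha 2 1) | apply: (Ha 1 3) | apply: (Ha 3 0)].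
  by split; [apply: (Hb 0 3) | apply: (Hb 3 1) | apply: (Hb 1 2) | apply: (Hb 2 0)].
Qed.

(** The two cycles cover eight of the twelve arcs, which leaves the four arcs on the diagonals. This
    list of six gives both the upper bound and, in the extremal case, distinctness. *)
Lemma colors4 (V : finType) (C : V -> V -> nat) (v1 v2 v3 v4 : V) (a b : nat) :
  (forall x, x \in [:: v1; v2; v3; v4]) ->
  [/\ C v1 v2 = a, C v2 v3 = a, C v3 v4 = a & C v4 v1 = a] ->
  [/\ C v1 v4 = b, C v4 v3 = b, C v3 v2 = b & C v2 v1 = b] ->
  {subset colors C <= [:: a; b; C v1 v3; C v3 v1; C v2 v4; C v4 v2]}.
Proof.
move=> V_all [a1 a2 a3 a4] [b1 b2 b3 b4] c /colorsP[x [y [ne_xy <-]]].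
move: (V_all x) (V_all y) ne_xy; rewrite !inE => /or4P[]/eqP-> /or4P[]/eqP->.
all: by rewrite ?(eqxx, a1, a2, a3, a4, b1, b2, b3, b4, orbT).
Qed.

Lemma ncolors_card4 (V : finType) (C : V -> V -> nat) :
  #|V| = 4 -> ~ has_rainbow_triangle C -> ncolors C <= 6.
Proof.
move=> V4 norb; rewrite leqNgt; apply/negP=> gt6.
have [v1 [v2 [v3 [v4 [a [b [_ V_all Ha Hb]]]]]]] := structure4 V4 norb (ltnW gt6).
by have := ncolors_leq (colors4 V_all Ha Hb); rewrite leqNgt gt6.
Qed.

Lemma is_f4 : is_f 4 7.
Proof.
apply: is_fI => [C|]; first by apply: ncolors_card4; rewrite card_ord.
(* Color 0 on the cycle 0, 1, 2, 3, color 1 on its reverse, colors 2 to 5 on the diagonals. *)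
by apply: (@extremal_table 4 6 [:: 9; 0; 2; 1;  1; 9; 0; 4;  3; 1; 9; 0;  0; 5; 1; 9]);
  vm_compute.
Qed.

(** * Reversal of all arcs, and colors saturated at a vertex *)

Definition reverse (V : finType) (C : V -> V -> nat) : V -> V -> nat := fun x y => C y x.

Lemma colors_reverse (V : finType) (C : V -> V -> nat) : colors (reverse C) =i colors C.
Proof.
by move=> c; apply/colorsP/colorsP=> -[x [y [ne_xy <-]]]; exists y, x; rewrite eq_sym.
Qed.

Lemma ncolors_reverse (V : finType) (C : V -> V -> nat) : ncolors (reverse C) = ncolors C.
Proof.
apply/eqP; rewrite eqn_leq; apply/andP; split; apply: ncolors_leq => c.
  by rewrite colors_reverse.
by rewrite -colors_reverse.
Qed.

Lemma reverse_no_rainbow (V : finType) (C : V -> V -> nat) :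
  ~ has_rainbow_triangle C -> ~ has_rainbow_triangle (reverse C).
Proof.
move=> norb [x [y [z [[h1 h2 h3] [h4 h5 h6]]]]]; apply: norb; exists z, y, x.
by split; split; rewrite eq_sym.
Qed.

Section Saturation.
Variables (V : finType) (C : V -> V -> nat).

Definition saturated (v : V) : seq nat :=
  [seq c <- colors C | c \notin colors (delv C v)].

Lemma saturated_uniq v : uniq (saturated v).
Proof. exact/filter_uniq/undup_uniq. Qed.

Lemma mem_saturated v c :
  (c \in saturated v) = (c \notin colors (delv C v)) && (c \in colors C).
Proof. by rewrite mem_filter. Qed.

Lemma ncolors_saturated v : ncolors C <= ncolors (delv C v) + size (saturated v).
Proof.
rewrite -size_cat; apply: ncolors_leq => c cC.
by rewrite mem_cat mem_saturated cC andbT orbN.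
Qed.

Lemma saturated_incident v c : c \in saturated v ->
  exists2 x, x != v & C v x = c \/ C x v = c.
Proof.
rewrite mem_saturated => /andP[c_delv /colorsP[x [y [ne_xy Ec]]]].
case: (eqVneq x v) => [Exv|ne_xv].
  by exists y; [rewrite -Exv eq_sym | left; rewrite -Exv].
case: (eqVneq y v) => [Eyv|ne_yv]; first by exists x => //; right; rewrite -Eyv.
by case/negP: c_delv; apply/colors_delvP; exists x, y.
Qed.

Lemma saturatedF v x y : x != v -> y != v -> x != y -> C x y \in saturated v = false.
Proof.
move=> ne_xv ne_yv ne_xy; rewrite mem_saturated andbC.
by apply/negP=> /andP[_ /negP[]]; apply/colors_delvP; exists x, y.
Qed.

Hypothesis norb : ~ has_rainbow_triangle C.

(** The arc from [x] to [y] avoids [v], so its color is not saturated at [v] and cannot be the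
    repeated color of the triangle. *)
Lemma saturated_triangle v x y : x != v -> y != v -> x != y ->
  C v x \in saturated v -> C y v \in saturated v -> C v x = C y v.
Proof.
move=> ne_xv ne_yv ne_xy out_x in_y.
have [|E|E|//] := triangle_eq norb _ ne_xy ne_yv; first by rewrite eq_sym.
- by move: out_x; rewrite E saturatedF.
- by move: in_y; rewrite -E saturatedF.
Qed.

(** In the same triangle, the saturated color of the arc from [v] to [x] differs from both others,
    so these two must agree. *)
Lemma out_saturated_eq v x y : x != v -> y != v -> x != y ->
  C v x \in saturated v -> C y v \notin saturated v -> C x y = C y v.
Proof.
move=> ne_xv ne_yv ne_xy out_x in_y.
have [|E|//|E] := triangle_eq norb _ ne_xy ne_yv; first by rewrite eq_sym.
- by move: out_x; rewrite E saturatedF.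
- by move: in_y; rewrite E out_x.
Qed.

End Saturation.

Lemma saturated_reverse (V : finType) (C : V -> V -> nat) (v : V) :
  saturated (reverse C) v =i saturated C v.
Proof.
move=> c; rewrite !mem_saturated colors_reverse; congr (~~ _ && _).
by apply/colors_delvP/colors_delvP=> -[x [y [? ? ? <-]]]; exists y, x; split=> //; rewrite eq_sym.
Qed.

Lemma size_saturated_reverse (V : finType) (C : V -> V -> nat) (v : V) :
  size (saturated (reverse C) v) = size (saturated C v).
Proof.
apply/eqP; rewrite -uniq_size_uniq ?saturated_uniq //; exact: saturated_reverse.
Qed.

(** * Order 5: the shapes found by the search *)

Definition pairs5 : seq (seq nat) :=
  [:: [:: 0; 1]; [:: 0; 2]; [:: 0; 3]; [:: 0; 4]; [:: 1; 2];
      [:: 1; 3]; [:: 1; 4]; [:: 2; 3]; [:: 2; 4]; [:: 3; 4]].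

Definition leaf5 (s : seq nat) : bool :=
  has (fun i0 => monochromatic 5 (fun i j => (i == i0) || (j == i0)) s) (iota 0 5) ||
  has (fun A : seq nat =>
    [|| monochromatic 5 (fun i j => ~~ ((i \in A) && (j \notin A))) s,
        monochromatic 5 (fun i j => ~~ ((j \in A) && (i \notin A))) s
      | monochromatic 5 (fun i j => (i \in A) != (j \in A)) s]) pairs5.

(** Only the monochromatic parts of types I, II (in both directions) and III are kept; the
    conditions on the remaining colors are recovered by counting. *)
Definition shape5 (V : finType) (C : V -> V -> nat) : Prop :=
  (exists (v : V) (c : nat), forall u, u != v -> C u v = c /\ C v u = c) \/
  exists2 A : {set V}, #|A| = 2 &
    [\/ exists c, forall x y, x != y -> ~~ ((x \in A) && (y \notin A)) -> C x y = c,
        exists c, forall x y, x != y -> ~~ ((y \in A) && (x \notin A)) -> C x y = c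
      | exists c, forall x y, (x \in A) != (y \in A) -> C x y = c].

Lemma shape5_reverse (V : finType) (C : V -> V -> nat) : shape5 (reverse C) -> shape5 C.
Proof.
case=> [[v [c H]]|[A A2 H]].
  by left; exists v, c => u /H[].
right; exists A => //; case: H => -[c H].
- by constructor 2; exists c => x y ne_xy; apply: H; rewrite eq_sym.
- by constructor 1; exists c => x y ne_xy; apply: H; rewrite eq_sym.
- by constructor 3; exists c => x y ne_xy; apply: H; rewrite eq_sym.
Qed.

Lemma leaf5_shape (V : finType) (C : V -> V -> nat) (x0 : V) (vs : seq V) (s : seq nat) :
  uniq vs -> (forall x, x \in vs) -> size vs = 5 ->
  map (code_color C x0 vs) s = map (code_color C x0 vs) (discrete_classes (size vs)) ->
  leaf5 s -> shape5 C.
Proof.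
move=> vs_uniq vs_all vs_size Es.
have n_gt1 : 1 < size vs by rewrite vs_size.
have mono P := monochromatic_index (P := P) vs_all n_gt1 Es.
rewrite vs_size in mono.
case/orP=> /hasP[].
  move=> i; rewrite mem_iota => /= lt_i /mono[c Hc]; left; exists (nth x0 vs i), c => u ne_u.
  by split; apply: Hc; rewrite // ?index_uniq ?vs_size ?eqxx ?orbT // eq_sym.
move=> A A_pairs H; right.
have /and3P[A_uniq A_size A_lt] : [&& uniq A, size A == 2 & all (gtn 5) A].
  by move: A A_pairs {H}; apply/allP.
have lt5 i : i \in A -> i < size vs by move/(allP A_lt); rewrite vs_size.
pose B := [set x in [seq nth x0 vs i | i <- A]].
have memB x : (x \in B) = (index x vs \in A).
  rewrite inE; apply/mapP/idP => [[i iA ->]|xA]; first by rewrite index_uniq ?lt5.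
  by exists (index x vs); rewrite ?nth_index.
exists B.
  rewrite cardsE; have /card_uniqP-> : uniq [seq nth x0 vs i | i <- A].
    by rewrite map_inj_in_uniq // => i j /lt5 lt_i /lt5 lt_j /eqP; rewrite nth_uniq // => /eqP.
  by rewrite size_map (eqP A_size).
case/or3P: H => /mono[c Hc]; [constructor 1 | constructor 2 | constructor 3]; exists c => x y.
- by rewrite !memB; apply: Hc.
- by rewrite !memB; apply: Hc.
- move=> ne_xy; apply: Hc; last by rewrite -!memB.
  by apply: contraNneq ne_xy => ->.
Qed.

(** Positions 0 to 3 carry the two cycles of [structure4] on the graph without [v]; [v] is at
    position 4. *)
Definition cycle_eqs : seq ((nat * nat) * (nat * nat)) :=
  [:: ((0, 1), (1, 2)); ((0, 1), (2, 3)); ((0, 1), (3, 0));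
      ((0, 3), (3, 2)); ((0, 3), (2, 1)); ((0, 3), (1, 0))].

Lemma search_cycle5 :
  search 7 leaf5 (triangles 5)
    (initial_classes 5 [seq (code 5 e.1, code 5 e.2) | e <- cycle_eqs]) [::].
Proof. by vm_compute. Qed.

(** Position 0 is [v], and positions 1 and 2 are heads of saturated arcs leaving it; these are the
    instances of [out_saturated_eq]. *)
Definition out_eqs : seq ((nat * nat) * (nat * nat)) :=
  [:: ((1, 2), (2, 0)); ((1, 3), (3, 0)); ((1, 4), (4, 0));
      ((2, 1), (1, 0)); ((2, 3), (3, 0)); ((2, 4), (4, 0))].

Lemma search_out5 :
  search 7 leaf5 (triangles 5)
    (initial_classes 5 [seq (code 5 e.1, code 5 e.2) | e <- out_eqs]) [::].
Proof. by vm_compute. Qed.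

(* The colors of the arcs (0, 1) and (1, 0) are distinct and saturated at 0. *)
Definition mixed_neqs : seq ((nat * nat) * (nat * nat)) :=
  ((0, 1), (1, 0)) ::
  [seq (e, a) | e <- [:: (0, 1); (1, 0)],
                a <- [seq (i, j) | i <- iota 1 4, j <- [seq j <- iota 1 4 | j != i]]].

Lemma search_mixed5 :
  search 7 leaf5 (triangles 5) (initial_classes 5 [::])
    [seq (code 5 e.1, code 5 e.2) | e <- mixed_neqs].
Proof. by vm_compute. Qed.

Lemma enum5 (V : finType) (s : seq V) : #|V| = 5 -> uniq s ->
  exists t, [/\ uniq (s ++ t), forall x, x \in s ++ t & size (s ++ t) = 5].
Proof. by move=> <-; exact: enum_prefix. Qed.

Section Shape5.
Variables (V : finType) (C : V -> V -> nat).
Hypotheses (V5 : #|V| = 5) (norb : ~ has_rainbow_triangle C) (ge7 : 7 <= ncolors C).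

(** Deleting [v] loses at most one color, so six remain on four vertices and [structure4]
    applies. *)
Lemma shape5_cycle (v : V) : size (saturated C v) <= 1 -> shape5 C.
Proof.
move=> sat_le1; pose W := {x : V | x \in [set~ v]}.
have W4 : #|{: W}| = 4 by rewrite card_induced cardsC1 V5.
have ge6 : 6 <= ncolors (delv C v).
  have := leq_trans ge7 (ncolors_saturated C v); move: sat_le1; lia.
have [v1 [v2 [v3 [v4 [a [b [v_uniq v_all [a1 a2 a3 a4] [b1 b2 b3 b4]]]]]]]] :=
  structure4 W4 (induced_no_rainbow (S := [set~ v]) norb) ge6.
pose vs := map val [:: v1; v2; v3; v4] ++ [:: v].
have vs_uniq : uniq vs.
  rewrite /vs cats1 rcons_uniq (map_inj_uniq val_inj) v_uniq andbT.
  by apply/negP=> /mapP[w _ Ev]; have := valP w; rewrite !inE -Ev eqxx.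
have vs_all x : x \in vs.
  rewrite /vs mem_cat; case: (eqVneq x v) => [->|ne_xv]; first by rewrite mem_head orbT.
  have xW : x \in [set~ v] by rewrite !inE.
  by rewrite (map_f val (v_all (exist _ x xW) : exist _ x xW \in [:: v1; v2; v3; v4])).
have [e||s Es] := search_colors (x0 := v) vs_uniq vs_all isT norb ge7 _ _ search_cycle5
  (neqs := [::]); [|by []|exact: (leaf5_shape vs_uniq vs_all erefl Es)].
rewrite /delv /induced in a1 a2 a3 a4 b1 b2 b3 b4.
rewrite !inE => /or4P[/eqP->|/eqP->|/eqP->|/or3P[]/eqP->] /=.
all: by rewrite ?(a1, a2, a3, a4, b1, b2, b3, b4).
Qed.

Lemma shape5_out (v x y : V) : x != v -> y != v -> x != y ->
  C v x \in saturated C v -> C v y \in saturated C v ->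
  (forall z, z != v -> C z v \notin saturated C v) -> shape5 C.
Proof.
move=> ne_xv ne_yv ne_xy sat_x sat_y no_in.
have [||t []] := @enum5 V [:: v; x; y]; first by [].
  by rewrite /= !inE !negb_or eq_sym ne_xv eq_sym ne_yv ne_xy.
case: t => [|w3 [|w4 [|? ?]]] //; set vs := _ ++ _ => vs_uniq vs_all _.
have eq_in (u z : V) : u \in [:: x; y] -> z != v -> u != z -> C u z = C z v.
  move=> u_xy ne_zv ne_uz; apply: (out_saturated_eq norb); rewrite ?no_in //.
    by move: u_xy; rewrite !inE => /orP[]/eqP->.
  by move: u_xy; rewrite !inE => /orP[]/eqP->.
have eq_nth i j : i \in [:: 1; 2] -> 0 < j < 5 -> i != j ->
    C (nth v vs i) (nth v vs j) = C (nth v vs j) (nth v vs 0).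
  move=> i12 /andP[j_gt0 lt_j5] ne_ij.
  have lt_i5 : i < 5 by move: i12; rewrite !inE => /orP[]/eqP->.
  apply: eq_in; last by rewrite nth_uniq.
    by move: i12; rewrite !inE => /orP[]/eqP->; rewrite eqxx ?orbT.
  by rewrite -[X in _ != X]/(nth v vs 0) nth_uniq // -lt0n.
have [e||s Es] := search_colors (x0 := v) vs_uniq vs_all isT norb ge7 _ _ search_out5
  (neqs := [::]); [|by []|exact: (leaf5_shape vs_uniq vs_all erefl Es)].
by rewrite !inE => /or4P[/eqP->|/eqP->|/eqP->|/or3P[]/eqP->]; split=> //; apply: eq_nth.
Qed.

(** Two distinct saturated colors on opposite arcs differ from the colors of all twelve arcs
    avoiding [v]; these inequalities start the search. *)
Lemma shape5_mixed (v x : V) : x != v -> C v x != C x v ->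
  C v x \in saturated C v -> C x v \in saturated C v -> shape5 C.
Proof.
move=> ne_xv ne_c sat_out sat_in.
have [||t []] := @enum5 V [:: v; x]; first by [].
  by rewrite /= !inE eq_sym ne_xv.
case: t => [|w2 [|w3 [|w4 [|? ?]]]] //; set vs := _ ++ _ => vs_uniq vs_all _.
have [|e|s Es] := search_colors (x0 := v) vs_uniq vs_all isT norb ge7 _ _ search_mixed5
  (eqs := [::]); [by []| |exact: (leaf5_shape vs_uniq vs_all erefl Es)].
move=> e_neqs; split.
  pose ok (e : (nat * nat) * (nat * nat)) :=
    [&& e.1.1 < 5, e.1.2 < 5, e.1.1 != e.1.2, e.2.1 < 5, e.2.2 < 5 & e.2.1 != e.2.2].
  exact: (allP (isT : all ok mixed_neqs) e e_neqs).
move: e_neqs; rewrite in_cons => /predU1P[->|]; first exact/eqP.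
case/allpairsP=> -[e1 [i j]] [/= e1_in ij_in ->] /=.
have /and4P[lt_i lt_j ne_ij ij_gt0] : [&& i < 5, j < 5, i != j & (0 < i) && (0 < j)].
  pose ok (a : nat * nat) := [&& a.1 < 5, a.2 < 5, a.1 != a.2 & (0 < a.1) && (0 < a.2)].
  exact: (allP (isT : all ok [seq (i, j) | i <- iota 1 4, j <- [seq j <- iota 1 4 | j != i]])
            _ ij_in).
have ne_v k : k < 5 -> 0 < k -> nth v vs k != v.
  by move=> lt_k k_gt0; rewrite -[X in _ != X]/(nth v vs 0) nth_uniq // -lt0n.
have /andP[i_gt0 j_gt0] := ij_gt0.
have : C (nth v vs i) (nth v vs j) \in saturated C v = false.
  by apply: saturatedF; rewrite ?ne_v // nth_uniq.
by move: e1_in; rewrite !inE => /orP[]/eqP-> /= + E; rewrite -E /= ?sat_out ?sat_in.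
Qed.

End Shape5.

(** If no saturated color enters [v], then [shape5_out] applies. Otherwise a saturated color enters
    from some z and differs from one of the two leaving colors; [saturated_triangle] forces that
    leaving arc to end in z, which is the case of [shape5_mixed]. *)
Lemma shape5_out_arcs (V : finType) (C : V -> V -> nat) (v x y : V) :
  #|V| = 5 -> ~ has_rainbow_triangle C -> 7 <= ncolors C ->
  x != v -> y != v -> C v x \in saturated C v -> C v y \in saturated C v ->
  C v x != C v y -> shape5 C.
Proof.
move=> V5 norb ge7 ne_xv ne_yv sat_x sat_y ne_c.
have ne_xy : x != y by apply: contraNneq ne_c => ->.
have [/existsP[z /andP[ne_zv sat_z]]|no_in] :=
  boolP [exists z, (z != v) && (C z v \in saturated C v)]; last first.
  apply: (shape5_out V5 norb ge7 ne_xv ne_yv) => // z ne_zv.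
  by apply: contraNN no_in => sat_z; apply/existsP; exists z; rewrite ne_zv.
have mixed u : u != v -> C v u \in saturated C v -> C v u != C z v -> shape5 C.
  move=> ne_uv sat_u ne_uz; case: (eqVneq u z) => [Euz|ne].
    by subst z; apply: (shape5_mixed V5 norb ge7 ne_uv).
  by rewrite (saturated_triangle norb ne_uv ne_zv ne) ?eqxx in ne_uz.
case: (eqVneq (C v x) (C z v)) => [Exz|]; last exact: mixed.
by apply: (mixed y) => //; rewrite -Exz eq_sym.
Qed.

Lemma structure5 (V : finType) (C : V -> V -> nat) :
  #|V| = 5 -> ~ has_rainbow_triangle C -> 7 <= ncolors C -> shape5 C.
Proof.
move=> V5 norb ge7; have /card_gt0P[v _] : 0 < #|V| by rewrite V5.
case: (leqP (size (saturated C v)) 1) => [|sat_gt1]; first exact: shape5_cycle.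
have := saturated_uniq C v.
case Es: (saturated C v) sat_gt1 => [|p [|q s]] // _ /=.
rewrite inE negb_or => /andP[/andP[ne_pq _] _].
have sat_p : p \in saturated C v by rewrite Es mem_head.
have sat_q : q \in saturated C v by rewrite Es !inE eqxx orbT.
have [x ne_xv Ex] := saturated_incident sat_p.
have [y ne_yv Ey] := saturated_incident sat_q.
have mixed a b : a != v -> b != v -> C v a \in saturated C v -> C b v \in saturated C v ->
    C v a != C b v -> shape5 C.
  move=> ne_av ne_bv sat_a sat_b ne_ab; case: (eqVneq a b) => [Eab|ne].
    by subst b; apply: (shape5_mixed V5 norb ge7 ne_av).
  by rewrite (saturated_triangle norb ne_av ne_bv ne) ?eqxx in ne_ab.
case: Ex Ey => Ex [] Ey; rewrite -Ex in ne_pq sat_p; rewrite -Ey in ne_pq sat_q.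
- exact: (shape5_out_arcs V5 norb ge7 ne_xv ne_yv).
- exact: (mixed x y).
- by apply: (mixed y x) => //; rewrite eq_sym.
(* Both saturated arcs enter [v]; in the reversed coloring they leave it. *)
apply: shape5_reverse; apply: (@shape5_out_arcs _ (reverse C) v x y) => //.
- exact: reverse_no_rainbow.
- by rewrite ncolors_reverse.
- by rewrite saturated_reverse.
- by rewrite saturated_reverse.
Qed.

(** * The bipartite extremal coloring and its number of colors *)

Definition max_colors (n : nat) : nat := n./2 * (n - n./2) + 1.

(** This increment is the number of colors that an extremal coloring must lose, at least, when a
    vertex is deleted. *)
Lemma max_colorsS (n : nat) : max_colors n.+1 = max_colors n + n.+1./2.
Proof.
rewrite /max_colors; have En := odd_double_half n; have En1 := odd_double_half n.+1.
move: En En1; rewrite /=; case: (odd n) => /=; rewrite -!addnn => En En1.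
  have -> : uphalf n = n./2.+1 by lia.
  have -> : n = n./2 + n./2 + 1 by lia.
  move: (n./2) => h; nia.
have -> : uphalf n = n./2 by lia.
have -> : n = n./2 + n./2 by lia.
move: (n./2) => h; nia.
Qed.

(** The successor reserves 0 for the common color of the remaining arcs. *)
Definition bipartite_color (n i j : nat) : nat :=
  if (i < n./2) && (n./2 <= j) then (i * n + j).+1 else 0.

Lemma extremal_bipartite (n : nat) : 1 < n ->
  exists2 C : 'I_n -> 'I_n -> nat, max_colors n <= ncolors C & ~ has_rainbow_triangle C.
Proof.
move=> n_gt1; pose m := n./2.
have m_gt0 : 0 < m by rewrite half_gt0.
have le_mn : m <= n by rewrite /m; lia.
pose cs := 0 :: [seq (i * n + j).+1 | i <- iota 0 m, j <- iota m (n - m)].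
have -> : max_colors n = size cs by rewrite /max_colors addn1 /= size_allpairs !size_iota.
apply: (@extremal_coloring n (bipartite_color n)).
- rewrite /= andbC allpairs_uniq ?iota_uniq //=.
    by apply/negP=> /allpairsP[p []].
  move=> _ _ /allpairsP[[i j] /= [_ + ->]] /allpairsP[[i' j'] /= [_ + ->]].
  rewrite !mem_iota !subnKC // => /andP[_ lt_j] /andP[_ lt_j'] [E].
  have := congr1 (modn^~ n) E; rewrite !modnMDl !modn_small // => Ej.
  by move: E; rewrite Ej => /addIn/eqP; rewrite eqn_pmul2r ?(ltnW n_gt1) // => /eqP->.
- move=> c; rewrite inE => /predU1P[->|/allpairsP[[i j] /= [+ + ->]]].
    exists 1, 0; rewrite /bipartite_color -/m [m <= 0]leqNgt m_gt0 andbF.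
    by split=> //; apply: ltnW.
  rewrite !mem_iota subnKC //= add0n => lt_im /andP[le_mj lt_jn].
  exists i, j; rewrite /bipartite_color lt_im le_mj; split=> //.
    exact: leq_trans lt_im le_mn.
  by rewrite neq_ltn (leq_trans lt_im le_mj).
(* A directed triangle has at most one arc from the first part to the second, so two of its arcs
   have color 0. *)
move=> i j k _ _ _ _ _ _; rewrite /bipartite_color -/m.
by case: (ltnP i m); case: (ltnP j m); case: (ltnP k m); rewrite /= ?eqxx ?orbT.
Qed.

Section Bipartite.
Variables (V : finType) (C : V -> V -> nat) (A : {set V}) (c : nat).
Hypothesis off_const : forall x y, x != y -> ~~ ((x \in A) && (y \notin A)) -> C x y = c.
Let cs := c :: [seq C p.1 p.2 | p <- enum (setX A (~: A))].

Let colors_cs : {subset colors C <= cs}.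
Proof.
move=> d /colorsP[x [y [ne_xy <-]]]; rewrite inE.
case: (boolP ((x \in A) && (y \notin A))) => [/andP[xA yA]|off]; last by rewrite off_const ?eqxx.
apply/orP; right; apply/mapP; exists (x, y) => //.
by rewrite mem_enum !inE xA.
Qed.

Let size_cs : size cs = #|A| * #|~: A| + 1.
Proof. by rewrite /= size_map -cardE cardsX addn1. Qed.

Lemma bipartite_ncolors : ncolors C <= #|A| * #|~: A| + 1.
Proof. by rewrite -size_cs; apply: ncolors_leq. Qed.

(** If the maximum is attained, the list [cs] has no repetition, which says at once that the arcs
    out of [A] are rainbow and that they avoid [c]. *)
Lemma bipartite_structure : #|A| * #|~: A| + 1 <= ncolors C -> bip_structure C A (~: A).
Proof.
rewrite -size_cs => /(ncolors_uniq colors_cs)/andP[c_notin /dinjectiveP inj].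
have memX x y : x \in A -> y \in ~: A -> (x, y) \in setX A (~: A).
  by move=> *; rewrite in_setX; apply/andP.
split=> [x1 y1 x2 y2 x1A y1A x2A y2A E|].
  by have [] := inj (x1, y1) (x2, y2) (memX _ _ x1A y1A) (memX _ _ x2A y2A) E.
exists c; split=> [x y ne_xy|x y xA yA].
  by rewrite inE; apply: off_const.
apply: contraNneq c_notin => <-; apply/mapP; exists (x, y) => //.
by rewrite mem_enum memX.
Qed.

End Bipartite.

Lemma partition2_setC (V : finType) (A : {set V}) (p q : nat) :
  #|A| = p -> #|V| = p + q -> partition2 A (~: A) p q.
Proof.
move=> Ap Vpq; split=> //; rewrite ?setICr ?setUCr //.
by move: (cardsC A); rewrite Ap Vpq => /addnI.
Qed.

(** * Order 5: from shapes to types by counting colors *)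

Lemma ncolors_card2 (V : finType) (C : V -> V -> nat) : #|V| = 2 -> ncolors C <= 2.
Proof.
move=> V2; have [s [s_uniq s_all s_size]] := @enum_prefix V [::] isT.
rewrite V2 in s_size; case: s s_uniq s_all s_size => [|x [|y [|z s]]] // _ V_xy _.
apply: (@ncolors_leq _ _ [:: C x y; C y x]) => d /colorsP[u [w [ne_uw <-]]].
move: (V_xy u) (V_xy w) ne_uw; rewrite !inE => /orP[]/eqP-> /orP[]/eqP->.
all: by rewrite ?eqxx ?orbT.
Qed.

Section TypesOf5.
Variables (V : finType) (C : V -> V -> nat).
Hypotheses (V5 : #|V| = 5) (norb : ~ has_rainbow_triangle C) (ge7 : 7 <= ncolors C).

(** Besides [c] only colors of the graph without [v] occur, at most six by the bound for order 4.
    Seven colors thus force exactly six there, with [c] a new one. *)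
Lemma shape5_typeI (v : V) (c : nat) :
  (forall u, u != v -> C u v = c /\ C v u = c) -> ncolors C <= 7 /\ typeI C.
Proof.
move=> Hc; have W4 : #|{: {x : V | x \in [set~ v]}}| = 4 by rewrite card_induced cardsC1 V5.
have norb' : ~ has_rainbow_triangle (delv C v) by apply: induced_no_rainbow.
have le6 := ncolors_card4 W4 norb'.
have sub : {subset colors C <= c :: colors (delv C v)}.
  move=> d /colorsP[x [y [ne_xy <-]]]; rewrite inE.
  case: (eqVneq x v) ne_xy => [->|ne_xv ne_xy].
    by rewrite eq_sym => /Hc[_ ->]; rewrite eqxx.
  case: (eqVneq y v) => [->|ne_yv]; first by have [-> _] := Hc x ne_xv; rewrite eqxx.
  by apply/orP; right; apply/colors_delvP; exists x, y.
have le_sub := ncolors_leq sub.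
split; first exact: leq_trans le_sub _.
have Eq6 : ncolors (delv C v) = 6.
  by apply/eqP; rewrite eqn_leq le6 -ltnS (leq_trans ge7 le_sub).
exists v, c; split=> //; split; last first.
  have : uniq (c :: colors (delv C v)) by apply: ncolors_uniq sub (leq_trans _ ge7).
  by rewrite cons_uniq => /andP[].
by split=> //; split=> //; exists 7; rewrite Eq6; split=> //; exact: is_f4.
Qed.

Lemma shape5_typeII (A : {set V}) : #|A| = 2 ->
  (exists c, forall x y, x != y -> ~~ ((x \in A) && (y \notin A)) -> C x y = c) \/
  (exists c, forall x y, x != y -> ~~ ((y \in A) && (x \notin A)) -> C x y = c) ->
  ncolors C <= 7 /\ typeII C.
Proof.
move=> A2 H; have part : partition2 A (~: A) 2 3 by apply: partition2_setC.
have [_ _ _ A3] := part.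
case: H => -[c Hc].
  split; first by have := bipartite_ncolors Hc; rewrite A2 A3.
  exists A, (~: A); split=> //; left.
  by apply: (bipartite_structure Hc); rewrite A2 A3.
have Hc' x y : x != y -> ~~ ((x \in ~: A) && (y \notin ~: A)) -> C x y = c.
  by move=> ne_xy; rewrite !inE negbK andbC; apply: Hc.
split; first by have := bipartite_ncolors Hc'; rewrite setCK A2 A3.
exists A, (~: A); split=> //; right; rewrite -{2}(setCK A).
by apply: (bipartite_structure Hc'); rewrite setCK A2 A3.
Qed.

(** The bounds 2, 4 and 1 for the two parts and the arcs between them add up to 7, so all are
    attained and the three color sets are disjoint. *)
Lemma shape5_typeIII (A : {set V}) (g : nat) : #|A| = 2 ->
  (forall x y, (x \in A) != (y \in A) -> C x y = g) ->
  ncolors C <= 7 /\ typeIII C.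
Proof.
move=> A2 Hg; have part : partition2 A (~: A) 2 3 by apply: partition2_setC.
have [_ _ _ B3] := part; set B := ~: A in part B3.
have norbB : ~ has_rainbow_triangle (induced C B) by apply: induced_no_rainbow.
have le2 : ncolors (induced C A) <= 2 by rewrite ncolors_card2 ?card_induced.
have le4 : ncolors (induced C B) <= 4 by rewrite ncolors_card3 ?card_induced.
have sub : {subset colors C <= colors (induced C A) ++ colors (induced C B) ++ [:: g]}.
  move=> d /colorsP[x [y [ne_xy <-]]]; rewrite !mem_cat inE.
  case: (boolP (x \in A)) => xA; case: (boolP (y \in A)) => yA.
  - by apply/orP; left; apply/colors_inducedP; exists x, y.
  - by rewrite Hg ?eqxx ?orbT // xA (negPf yA).
  - by rewrite Hg ?eqxx ?orbT // (negPf xA) yA.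
  apply/orP; right; apply/orP; left; apply/colors_inducedP.
  by exists x, y; rewrite !inE xA yA.
have le_sub := ncolors_leq sub; rewrite !size_cat /= in le_sub.
have le7 : size (colors (induced C A) ++ colors (induced C B) ++ [:: g]) <= 7.
  by rewrite !size_cat (leq_add le2 (leq_add le4 (leqnn 1))).
have uniq7 := ncolors_uniq sub (leq_trans le7 ge7).
have [EA EB] : ncolors (induced C A) = 2 /\ ncolors (induced C B) = 4.
  by move: le2 le4 le_sub ge7; rewrite /ncolors; clear; lia.
split; first by move: le_sub EA EB; rewrite /ncolors; clear; lia.
have inGB : inG 3 (induced C B).
  split; first by rewrite card_induced.
  by split=> //; exists 5; rewrite EB; split=> //; exact: is_f3.
exists A, B; move: EA EB inGB uniq7; rewrite /ncolors.
case: (colors (induced C A)) => [|a [|b [|? ?]]] // _.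
case EB: (colors (induced C B)) => [|c [|d [|e [|f [|? ?]]]]] // _ inGB uniq7.
exists a, b, c, d, e, f, g; split=> //.
move=> x y; rewrite !inE => H; apply: Hg.
by move: H; do 2![case: (_ \in A)].
Qed.

Lemma shape5_types : shape5 C -> ncolors C <= 7 /\ [\/ typeI C, typeII C | typeIII C].
Proof.
case=> [[v [c /shape5_typeI[]]]|[A A2]]; first by split=> //; constructor 1.
case=> [Hc|Hc|[g /(shape5_typeIII A2)[]]]; last by split=> //; constructor 3.
  by have [] := shape5_typeII A2 (or_introl Hc); split=> //; constructor 2.
by have [] := shape5_typeII A2 (or_intror Hc); split=> //; constructor 2.
Qed.

End TypesOf5.

Lemma ncolors_card5 (V : finType) (C : V -> V -> nat) :
  #|V| = 5 -> ~ has_rainbow_triangle C -> ncolors C <= 7.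
Proof.
move=> V5 norb; case: (leqP (ncolors C) 6) => [/leqW//|ge7].
by have [] := shape5_types V5 norb ge7 (structure5 V5 norb ge7).
Qed.

Lemma is_f5 : is_f 5 8.
Proof.
apply: is_fI => [C|]; first by apply: ncolors_card5; rewrite card_ord.
(* [max_colors 5] computes to 7. *)
exact: (@extremal_bipartite 5).
Qed.

(** * Order at least 6: sources and sinks *)

Lemma exists_third (s : seq nat) (p q : nat) : uniq s -> 2 < size s ->
  exists r, [/\ r \in s, r != p & r != q].
Proof.
move=> s_uniq s_gt2; case: (boolP (has (predC (mem [:: p; q])) s)) => [/hasP[r rs]|].
  by rewrite /= !inE negb_or => /andP[]; exists r.
move/hasPn=> sub; have /(uniq_leq_size s_uniq) : {subset s <= [:: p; q]}.
  by move=> r /sub; rewrite /= negbK.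
by rewrite leqNgt s_gt2.
Qed.

(* The sinks of C are the sources of reverse C. *)
Definition source (V : finType) (C : V -> V -> nat) (v : V) : bool :=
  [forall x, (x != v) ==> (C x v \notin saturated C v)].

Lemma sourceP (V : finType) (C : V -> V -> nat) (v : V) :
  reflect (forall x, x != v -> C x v \notin saturated C v) (source C v).
Proof. by apply: (iffP forallP) => H x; apply/implyP/H. Qed.

(** Suppose saturated arcs enter from y and leave to x. By [saturated_triangle], any further
    saturated color lies on the arc from v to y or from x to v. If the two given colors differ, then
    x = y and no third color fits. If they agree, two further colors occupy these two arcs, which
    again forces x = y, a contradiction. *)
Lemma source_or_sink (V : finType) (C : V -> V -> nat) (v : V) :
  ~ has_rainbow_triangle C -> 2 < size (saturated C v) ->
  source C v || source (reverse C) v.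
Proof.
move=> norb gt2; rewrite -[_ || _]negbK negb_or; apply/negP.
rewrite /source !negb_forall => /andP[/existsP[y +] /existsP[x +]].
rewrite !negb_imply => /and3P[ne_yv in_y _] /and3P[ne_xv out_x _].
rewrite saturated_reverse /reverse in out_x.
have third := exists_third _ _ (saturated_uniq C v) gt2.
have out_of u w : u != v -> w != v -> C v u \in saturated C v ->
    C w v \in saturated C v -> C v u != C w v -> u = w.
  move=> ne_uv ne_wv sat_u sat_w ne; apply/eqP/negPn/negP=> ne_uw.
  by rewrite (saturated_triangle norb ne_uv ne_wv ne_uw) ?eqxx in ne.
have locate r : r \in saturated C v -> r != C v x -> r != C y v -> r = C v y \/ r = C x v.
  move=> sat_r ne_rx ne_ry; have [z ne_zv [Er|Er]] := saturated_incident sat_r.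
    by left; rewrite -Er; congr (C v _); apply: out_of; rewrite ?Er.
  by right; rewrite -Er; congr (C _ v); apply/esym/out_of; rewrite ?Er // eq_sym.
case: (eqVneq (C v x) (C y v)) => [Exy|ne_xy]; last first.
  have Exy : x = y by apply: out_of.
  subst y; have [r [sat_r ne_rx ne_ry]] := third (C v x) (C x v).
  by case: (locate r sat_r ne_rx ne_ry) => Er; rewrite Er eqxx in ne_rx ne_ry.
have [r [sat_r ne_rx _]] := third (C v x) (C v x).
have [s [sat_s ne_sx ne_sr]] := third (C v x) r.
have ne_ry : r != C y v by rewrite -Exy.
have ne_sy : s != C y v by rewrite -Exy.
have contra a b : a \in saturated C v -> b \in saturated C v -> a != b ->
    a != C v x -> a = C v y -> b = C x v -> False.
  move=> sat_a sat_b ne_ab ne_ax Ea Eb; move: ne_ax.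
  by rewrite Ea (out_of y x) ?eqxx // -?Ea -?Eb.
case: (locate r sat_r ne_rx ne_ry) (locate s sat_s ne_sx ne_sy) => [Er|Er] [Es|Es].
- by rewrite Er Es eqxx in ne_sr.
- by apply: (contra r s) => //; rewrite eq_sym.
- exact: (contra s r).
by rewrite Er Es eqxx in ne_sr.
Qed.

Lemma source_not_sink (V : finType) (C : V -> V -> nat) (v : V) :
  0 < size (saturated C v) -> source C v -> ~~ source (reverse C) v.
Proof.
case Es: (saturated C v) => [//|c s] _ /sourceP no_in; apply/negP=> /sourceP no_out.
have sat_c : c \in saturated C v by rewrite Es mem_head.
have [x ne_xv [Ec|Ec]] := saturated_incident sat_c.
  by have := no_out x ne_xv; rewrite saturated_reverse /reverse Ec sat_c.
by have := no_in x ne_xv; rewrite Ec sat_c.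
Qed.

(** If [x] were a source, some saturated color would leave [x] to a vertex w other than [v]. By
    [out_saturated_eq] at [v] it is also the color of the arc from w to [v], which avoids [x]. *)
Lemma source_neighbour (V : finType) (C : V -> V -> nat) (v x : V) :
  ~ has_rainbow_triangle C -> 2 < size (saturated C x) ->
  source C v -> x != v -> C v x \in saturated C v -> source (reverse C) x.
Proof.
move=> norb gt2 /sourceP no_in ne_xv out_x.
case/orP: (source_or_sink norb gt2) => // /sourceP no_in_x.
have [c [sat_c ne_c _]] := exists_third (C x v) (C x v) (saturated_uniq C x) gt2.
have [w ne_wx [Ec|Ec]] := saturated_incident sat_c; last first.
  by have := no_in_x w ne_wx; rewrite Ec sat_c.
case: (eqVneq w v) => [Ewv|ne_wv]; first by rewrite -Ec Ewv eqxx in ne_c.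
have ne_xw : x != w by rewrite eq_sym.
move: sat_c; rewrite -Ec (out_saturated_eq norb ne_xv ne_wv ne_xw out_x) ?no_in //.
by rewrite saturatedF // eq_sym.
Qed.

(** All saturated colors of a source lie on arcs leaving to sinks, so choosing one arc per color
    bounds their number. *)
Lemma source_leq (V : finType) (C : V -> V -> nat) (v : V) :
  ~ has_rainbow_triangle C -> (forall u, 2 < size (saturated C u)) -> source C v ->
  size (saturated C v) <=
    #|[set x in [set x | source (reverse C) x] | C v x \in saturated C v]|.
Proof.
move=> norb gt2 src; rewrite cardE -(size_map (C v)).
apply: uniq_leq_size (saturated_uniq C v) _ => c sat_c.
have [x ne_xv [Ec|Ec]] := saturated_incident sat_c; last first.
  by have /sourceP/(_ x ne_xv) := src; rewrite Ec sat_c.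
apply/mapP; exists x => //; rewrite mem_enum !inE Ec sat_c andbT.
by apply: (source_neighbour (v := v)); rewrite // Ec.
Qed.

Section Large.
Variables (V : finType) (C : V -> V -> nat) (m : nat).
Hypotheses (norb : ~ has_rainbow_triangle C) (m_gt2 : 2 < m).
Hypothesis sat_m : forall v, m <= size (saturated C v).
Let X := [set x | source C x].
Let gt2 v : 2 < size (saturated C v) := leq_trans m_gt2 (sat_m v).

Lemma sinkE v : source (reverse C) v = (v \notin X).
Proof.
rewrite inE; apply/idP/idP => [snk|nsrc].
  by apply/negP=> src; have := source_not_sink (ltnW (ltnW (gt2 v))) src; rewrite snk.
by have := source_or_sink norb (gt2 v); rewrite (negPf nsrc).
Qed.

Let source_card v : v \in X -> m <= #|[set x in ~: X | C v x \in saturated C v]|.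
Proof.
rewrite inE => src; apply: leq_trans (sat_m v) _.
apply: leq_trans (source_leq norb gt2 src) _.
by apply/subset_leq_card/subsetP=> x; rewrite !inE sinkE inE.
Qed.

Let sink_card v : v \notin X -> m <= #|[set x in X | C x v \in saturated C v]|.
Proof.
rewrite -sinkE => snk; apply: leq_trans (sat_m v) _; rewrite -size_saturated_reverse.
have gt2' u : 2 < size (saturated (reverse C) u) by rewrite size_saturated_reverse.
apply: leq_trans (source_leq (reverse_no_rainbow norb) gt2' snk) _.
by apply/subset_leq_card/subsetP=> x; rewrite !inE saturated_reverse.
Qed.

(** Any vertex shows that the opposite class has at least [m] elements; a member of that class then
    gives the same for its own opposite. *)
Lemma sources_card : 0 < #|V| -> m <= #|X| /\ m <= #|~: X|.
Proof.
have m_gt0 := ltnW (ltnW m_gt2).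
have leX v : v \in X -> m <= #|~: X|.
  move=> /source_card/leq_trans-> //; apply/subset_leq_card/subsetP=> x.
  by rewrite inE => /andP[].
have leY v : v \notin X -> m <= #|X|.
  move=> /sink_card/leq_trans-> //; apply/subset_leq_card/subsetP=> x.
  by rewrite inE => /andP[].
case/card_gt0P=> v _; case: (boolP (v \in X)) => vX.
  have leY' := leX v vX; split=> //.
  have /card_gt0P[w] := leq_trans m_gt0 leY'; rewrite inE; exact: leY.
have leX' := leY v vX; split=> //.
by have /card_gt0P[w /leX] := leq_trans m_gt0 leX'.
Qed.

(** With exactly [m] sources, each sink receives a saturated arc from every one of them. Then
    [out_saturated_eq] in the reversed coloring relates all arcs not leading from a source to a
    sink. *)
Lemma sources_constant : #|X| = m -> 1 < #|~: X| ->
  exists c, forall x y, x != y -> ~~ ((x \in X) && (y \notin X)) -> C x y = c.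
Proof.
move=> Xm /card_gt1P[y0 [y1 []]]; rewrite !in_setC => y0X y1X ne_y01.
have satXY x y : x \in X -> y \notin X -> C x y \in saturated C y.
  move=> xX yX; have le_m := sink_card yX.
  have sub : [set x in X | C x y \in saturated C y] \subset X.
    by apply/subsetP=> u; rewrite inE => /andP[].
  have /eqP E : [set x in X | C x y \in saturated C y] == X.
    by rewrite eqEcard sub Xm.
  by move: xX; rewrite -{1}E inE => /andP[].
have eqXY x y z : x \in X -> y \notin X -> z != x -> z != y -> C z x = C y z.
  move=> xX yX ne_zx ne_zy.
  have ne_xy : x != y by apply: contraNneq yX => <-.
  apply: (@out_saturated_eq _ (reverse C) (reverse_no_rainbow norb) y x z) => //.
  - by rewrite eq_sym.
  - by rewrite saturated_reverse satXY.
  by have /sourceP/(_ z ne_zy) : source (reverse C) y by rewrite sinkE.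
have X_gt1 : 1 < #|X| by rewrite Xm ltnW.
have nXY x y : x \in X -> y \notin X -> x != y by move=> xX; apply: contraNneq => <-.
(* For another source [w], both colors equal [C x w]. *)
have YX_left x y y' : x \in X -> y \notin X -> y' \notin X -> C y x = C y' x.
  move=> xX yX y'X.
  have [w wX ne_xw] : exists2 w, w \in X & x != w.
    have /card_gt1P[a [b [aX bX ne_ab]]] := X_gt1.
    by case: (eqVneq x a) => [->|ne_xa]; [exists b | exists a].
  by rewrite -(eqXY w y x) // ?nXY // -(eqXY w y' x) // nXY.
(* For another sink [w], both colors equal [C w y]. *)
have YX_right x x' y : x \in X -> x' \in X -> y \notin X -> C y x = C y x'.
  move=> xX x'X yX.
  have [w wX ne_yw] : exists2 w, w \notin X & y != w.
    by case: (eqVneq y y0) => [->|ne_yy0]; [exists y1 | exists y0].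
  by rewrite (eqXY x w y) ?(eqXY x' w y) // eq_sym nXY.
have /card_gt0P[x0 x0X] := ltnW X_gt1.
(* Arcs from sinks to sources now share one color, and [eqXY] equates each arc inside a class with
   such an arc. *)
exists (C y0 x0) => x y ne_xy; rewrite negb_and negbK.
case: (boolP (x \in X)) => xX; case: (boolP (y \in X)) => yX // _.
- by rewrite (eqXY y y0 x) // ?nXY //; apply: YX_right.
- by rewrite (YX_left y x y0) //; apply: YX_right.
by rewrite -(eqXY x0 x y) // 1?eq_sym // ?nXY //; apply: YX_left.
Qed.

End Large.

Lemma ncolors_large (n : nat) (V : finType) (C : V -> V -> nat) :
  4 < n -> #|V| = n -> ~ has_rainbow_triangle C -> ncolors C <= max_colors n.
Proof.
elim: n V C => // n IH V C; rewrite ltnS leq_eqVlt => /predU1P[<-|n_gt4] Vn norb.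
  exact: ncolors_card5.
rewrite leqNgt; apply/negP=> gt_max.
have sat v : n.+1./2.+1 <= size (saturated C v).
  have Wn : #|{: {x : V | x \in [set~ v]}}| = n by rewrite card_induced cardsC1 Vn.
  have le_max : ncolors (delv C v) <= max_colors n.
    by apply: IH => //; apply: induced_no_rainbow.
  have := leq_trans gt_max (ncolors_saturated C v); rewrite max_colorsS.
  by move: le_max; clear; lia.
have n_gt2 : 2 < n.+1./2.+1 by lia.
have [] := sources_card norb n_gt2 sat; first by rewrite Vn.
(* Two complementary classes would have more than [n.+1] elements together. *)
set X := [set x | source C x]; have := cardsC X; rewrite Vn.
move: #|X| #|~: X| => a b; clear; lia.
Qed.

Lemma is_f_large (n : nat) : 4 < n -> is_f n (max_colors n).+1.
Proof.
move=> n_gt4; apply: is_fI => [C|]; first by apply: ncolors_large; rewrite ?card_ord.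
by apply: extremal_bipartite; apply: leq_trans n_gt4.
Qed.

(** Both classes have at least [n./2] elements and together [n], so one has exactly [n./2]. If it is
    the class of sinks, the argument is applied to the reversed coloring. *)
Lemma structure_large (n : nat) (V : finType) (C : V -> V -> nat) :
  5 < n -> #|V| = n -> ~ has_rainbow_triangle C -> max_colors n <= ncolors C ->
  exists A B : {set V}, partition2 A B n./2 (n - n./2) /\
    (bip_structure C A B \/ bip_structure C B A).
Proof.
move=> n_gt5 Vn norb ge_max.
have sat v : n./2 <= size (saturated C v).
  case: n n_gt5 Vn ge_max => // n n_gt4 Vn ge_max.
  have Wn : #|{: {x : V | x \in [set~ v]}}| = n by rewrite card_induced cardsC1 Vn.
  have := ncolors_large n_gt4 Wn (induced_no_rainbow (S := [set~ v]) norb).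
  have := leq_trans ge_max (ncolors_saturated C v); rewrite max_colorsS.
  by clear; rewrite /delv; lia.
have n2_gt2 : 2 < n./2 by lia.
have Vn2 : #|V| = n./2 + (n - n./2) by lia.
have half_structure (D : V -> V -> nat) : ~ has_rainbow_triangle D ->
    max_colors n <= ncolors D -> (forall v, n./2 <= size (saturated D v)) ->
    let A := [set x | source D x] in #|A| = n./2 ->
    partition2 A (~: A) n./2 (n - n./2) /\ bip_structure D A (~: A).
  move=> norbD ge_maxD satD A An; have part := partition2_setC An Vn2; split=> //.
  have [_ _ _ Bn] := part.
  have [|c Hc] := sources_constant norbD n2_gt2 satD An; first by rewrite Bn; lia.
  by apply: (bipartite_structure Hc); rewrite An Bn.
have [|leX leY] := sources_card norb n2_gt2 sat; first by rewrite Vn; lia.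
have card_sum := cardsC [set x | source C x].
have [EX|EY] : #|[set x | source C x]| = n./2 \/ #|~: [set x | source C x]| = n./2.
- move: card_sum leX leY; rewrite Vn; move: #|_| #|~: _| => a b; clear; lia.
- have [part bip] := half_structure C norb ge_max sat EX.
  by eexists; eexists; split; [exact: part | left].
have Esink : [set x | source (reverse C) x] = ~: [set x | source C x].
  by apply/setP=> x; rewrite !inE (sinkE norb n2_gt2 sat) inE.
have [||v||part [inj [c [Hc nec]]]] := half_structure (reverse C).
- exact: reverse_no_rainbow.
- by rewrite ncolors_reverse.
- by rewrite size_saturated_reverse.
- by rewrite Esink.
eexists; eexists; split; [exact: part | right; split].
  by move=> x1 y1 x2 y2 x1A y1B x2A y2B E; have [] := inj y1 x1 y2 x2 y1B x1A y2B x2A E.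
exists c; split=> [x y ne_xy off|x y xA yB]; last exact: nec.
by apply: Hc; rewrite 1?eq_sym // andbC.
Qed.

Theorem theorem2 :
  (* (1) *)
  (forall (V : finType) (C : V -> V -> nat), inG 3 C ->
     exists x y z : V,
       [/\ x != y, y != z & z != x] /\
       [/\ size (undup [:: C x y; C y z; C z x]) = 2,
           size (undup [:: C x z; C z y; C y x]) = 2
         & all (fun col => col \notin [:: C x z; C z y; C y x])
               [:: C x y; C y z; C z x]]) /\
  (* (2) *)
  (forall (V : finType) (C : V -> V -> nat), inG 4 C ->
     exists (v1 v2 v3 v4 : V) (a b c d e f : nat),
       [/\ uniq [:: v1; v2; v3; v4],
           uniq [:: a; b; c; d; e; f],
           [/\ C v1 v2 = a, C v2 v3 = a, C v3 v4 = a & C v4 v1 = a],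
           [/\ C v1 v4 = b, C v4 v3 = b, C v3 v2 = b & C v2 v1 = b]
         & [/\ C v1 v3 = c, C v3 v1 = d, C v2 v4 = e & C v4 v2 = f]]) /\
  (* (3) *)
  (forall (V : finType) (C : V -> V -> nat), inG 5 C ->
     typeI C \/ typeII C \/ typeIII C) /\
  (* (4) *)
  (forall (n : nat) (V : finType) (C : V -> V -> nat), 6 <= n -> inG n C ->
     exists A B : {set V}, partition2 A B (n./2) (n - n./2) /\
       (bip_structure C A B \/ bip_structure C B A)).
Proof.
split; [|split; [|split]].
- move=> V C /(inG_ncolors is_f3)[V3 C4 norb].
  have [x [y [z [xyz_uniq V_xyz]]]] := card3P V3.
  exists x, y, z; split; last by apply: structure3 => //; rewrite C4.
  move: xyz_uniq; rewrite /= !inE negb_or => /and3P[/andP[-> ne_xz] -> _].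
  by rewrite eq_sym.
- move=> V C /(inG_ncolors is_f4)[V4 C6 norb].
  have [|v1 [v2 [v3 [v4 [a [b [v_uniq V_all Ha Hb]]]]]]] := structure4 V4 norb.
    by rewrite C6.
  exists v1, v2, v3, v4, a, b, (C v1 v3), (C v3 v1), (C v2 v4), (C v4 v2).
  (* Six colors inside a list of length six leave no repetition. *)
  by split=> //; apply: (ncolors_uniq (colors4 V_all Ha Hb)); rewrite C6.
- move=> V C /(inG_ncolors is_f5)[V5 C7 norb].
  have ge7 : 7 <= ncolors C by rewrite C7.
  have [_ []] := shape5_types V5 norb ge7 (structure5 V5 norb ge7); by tauto.
- move=> n V C n_gt5 /(inG_ncolors (is_f_large (ltnW n_gt5)))[Vn Cn norb].
  by apply: structure_large => //; rewrite Cn.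
Qed.
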